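(* Let $\ell\ge 2$ be an integer and let $H$ be an $\ell$-minimal graph. Then there exists a graph $G$ such that $H\in\mathcal{S}_2(G)$, i.e., $H$ can be obtained from $G$ by $2$-stretching one vertex.
   Context: All graphs are finite, simple, undirected. $\mathrm{STAB}(G)$ is the convex hull of incidence vectors of stable sets of $G$; $\mathrm{FRAC}(G)=\{x\in[0,1]^{V(G)}: x_i+x_j\le 1\ \forall\{i,j\}\in E(G)\}$. For $P\subseteq[0,1]^n$, $\mathrm{cone}(P)=\{(\lambda,\lambda x):\lambda\ge0,x\in P\}\subseteq\mathbb{R}^{n+1}$ (coordinates $0,\dots,n$); $\widehat{\mathrm{LS}}_+(P)$ is the set of symmetric PSD $(n+1)\times(n+1)$ matrices $Y$ with $Ye_0=\mathrm{diag}(Y)$ and $Ye_i,Y(e_0-e_i)\in\mathrm{cone}(P)$ for all $i\in[n]$; $\mathrm{LS}_+(P)=\{x:\exists Y\in\widehat{\mathrm{LS}}_+(P), Ye_0=(1,x)\}$; $\mathrm{LS}_+^k$ is the $k$-fold iterate ($\mathrm{LS}_+^0(P)=P$), $\mathrm{LS}_+^k(G)=\mathrm{LS}_+^k(\mathrm{FRAC}(G))$, and the $\mathrm{LS}_+$-rank $r_+(G)$ is the least $k\ge0$ with $\mathrm{LS}_+^k(G)=\mathrm{STAB}(G)$. A graph $G$ is $\ell$-minimal if $|V(G)|=3\ell$ and $r_+(G)=\ell$. Vertex stretching: given a graph $G$, a vertex $v$, an integer $p\ge2$ and nonempty proper subsets $A_1,\dots,A_p$ of the neighbourhood $\Gamma_G(v)$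 with $\bigcup_{\ell=1}^p A_\ell=\Gamma_G(v)$, the $p$-stretching of $v$ replaces $v$ by $p+1$ new vertices $v_0,v_1,\dots,v_p$ and, for each $\ell\in[p]$, joins $v_\ell$ to $v_0$ and to all vertices of $A_\ell$ (all other edges of $G-v$ are kept). $\mathcal{S}_p(G)$ denotes the set of graphs obtainable from $G$ by $p$-stretching one vertex. *)

(* Defs.v *)
From mathcomp Require Import all_boot all_order all_algebra.
From mathcomp Require Import classical_sets reals.

Set Implicit Arguments.
Unset Strict Implicit.
Unset Printing Implicit Defensive.

Import GRing.Theory Num.Theory.

Local Open Scope ring_scope.
Local Open Scope classical_set_scope.

Record sgraph := SGraph {
  vertex :> finType;
  adj : rel vertex;
  adj_sym : symmetric adj;
  adj_irrefl : irreflexive adj }.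

Definition neighbourhood (G : sgraph) (v : G) : {set G} :=
  [set u | adj v u]%SET.

Definition stable (G : sgraph) (S : {set G}) : Prop :=
  forall u v, u \in S -> v \in S -> ~~ adj u v.

Definition isomorphic (G H : sgraph) : Prop :=
  exists2 f : G -> H, bijective f & forall u v, adj (f u) (f v) = adj u v.

(* The stretched graph has vertex set (V(G) - v) + {v_0, v_1, ..., v_p}; here
   [inr None] is v_0 and [inr (Some k)], k : 'I_p, is v_{k+1}, whose
   neighbours are v_0 and the vertices of [A k]. *)
Section Stretch.
Variables (G : sgraph) (v : G) (p : nat) (A : 'I_p -> {set G}).

Definition stretch_vertex : finType :=
  ({u : G | u != v} + option 'I_p)%type.

Definition stretch_adj (a b : stretch_vertex) : bool :=
  match a, b with
  | inl x, inl y => adj (val x) (val y)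
  | inl x, inr (Some k) | inr (Some k), inl x => val x \in A k
  | inr None, inr (Some _) | inr (Some _), inr None => true
  | _, _ => false
  end.

Lemma stretch_adj_sym : symmetric stretch_adj.
Proof. by move=> [x|[k|]] [y|[j|]] //=; rewrite adj_sym. Qed.

Lemma stretch_adj_irrefl : irreflexive stretch_adj.
Proof. by move=> [x|[k|]] //=; rewrite adj_irrefl. Qed.

Definition stretch : sgraph := SGraph stretch_adj_sym stretch_adj_irrefl.

Definition stretch_data : Prop :=
  [/\ forall k, A k != finset.set0,
      forall k, A k \proper neighbourhood v
    & (\bigcup_k A k)%SET = neighbourhood v].

End Stretch.

(* The class S_p(G), closed under isomorphism (meant for p >= 2). *)
Definition stretchings (p : nat) (G H : sgraph) : Prop :=
  exists (v : G) (A : 'I_p -> {set G}),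
    stretch_data v A /\ isomorphic H (stretch v A).

Section Polytopes.
Variable R : realType.

Definition convex_hull (I : finType) (X : set {ffun I -> R}) :
    set {ffun I -> R} :=
  [set x | exists (m : nat) (a : 'I_m -> R) (y : 'I_m -> {ffun I -> R}),
     [/\ forall k, 0 <= a k, \sum_k a k = 1, forall k, X (y k)
       & x = [ffun i => \sum_k a k * y k i]]].

Definition incidence (I : finType) (S : {set I}) : {ffun I -> R} :=
  [ffun i => (i \in S)%:R].

Definition STAB (G : sgraph) : set {ffun G -> R} :=
  convex_hull [set x | exists2 S : {set G}, stable S & x = incidence S].

Definition FRAC (G : sgraph) : set {ffun G -> R} :=
  [set x | (forall i, 0 <= x i <= 1) /\
           (forall i j, adj i j -> x i + x j <= 1)].

(* R^{n+1} is indexed by [option I] with #|I| = n; the extra coordinate 0 is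
   [None]. *)
Definition homog (I : finType) (c : R) (x : {ffun I -> R}) :
    {ffun option I -> R} :=
  [ffun o => if o is Some i then x i else c].

Definition cone (I : finType) (P : set {ffun I -> R}) :
    set {ffun option I -> R} :=
  [set y | exists (c : R) (x : {ffun I -> R}),
     [/\ 0 <= c, P x & y = homog c [ffun i => c * x i]]].

Definition column (J : finType) (Y : J -> J -> R) (j : J) : {ffun J -> R} :=
  [ffun i => Y i j].

Definition psd (J : finType) (Y : J -> J -> R) : Prop :=
  (forall i j, Y i j = Y j i) /\
  (forall z : J -> R, 0 <= \sum_i \sum_j z i * Y i j * z j).

Definition LSplus_lift (I : finType) (P : set {ffun I -> R}) :
    set (option I -> option I -> R) :=
  [set Y | [/\ psd Y,
     column Y None = [ffun o => Y o o],
     forall i : I, cone P (column Y (Some i))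
   & forall i : I, cone P (column Y None - column Y (Some i))]].

Definition LSplus (I : finType) (P : set {ffun I -> R}) : set {ffun I -> R} :=
  [set x | exists2 Y, LSplus_lift P Y & column Y None = homog 1 x].

Definition LSplus_iter (k : nat) (G : sgraph) : set {ffun G -> R} :=
  iter k (@LSplus G) (@FRAC G).

(* r_+(G) = k *)
Definition has_LSplus_rank (G : sgraph) (k : nat) : Prop :=
  @LSplus_iter k G = @STAB G /\
  (forall j : nat, (j < k)%N -> @LSplus_iter j G <> @STAB G).

Definition minimal (l : nat) (G : sgraph) : Prop :=
  #|G| = (3 * l)%N /\ has_LSplus_rank G l.

End Polytopes.

(* Main.v *)
(* If [H] has [3 l] vertices and LS_+-rank [l], some point of LS_+^(l-1)
   violates a valid inequality [w . x <= b] of STAB with [w >= 0].  One LS_+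
   step proves such an inequality as soon as, for every vertex [i] in the support
   of [w], the inequality obtained by deleting [i] and its neighbours is already
   known.  If all degrees within the support are at least 2, this deletes at least
   3 vertices; a vertex of degree at most 1 lets one subtract an edge (or vertex)
   inequality and shrink the support.  So supports of size at most [3 k + 2] are
   handled by [k] steps, and the violated inequality has full support.  If all
   degrees in [H] were at least 3, one step would delete 4 vertices and [l - 1]
   steps would suffice; hence there is a vertex [v0] of degree 2.  Its neighbours
   [v1], [v2] are not adjacent (else subtract the triangle inequality), and neither
   neighbourhood contains the other (if [N(v1)] is in [N(v2)], every stable set
   missing [v0] and [v1] extends by one of them, so subtract the edge inequality).
   Merging [v0], [v1], [v2] into one vertex therefore undoes a 2-stretching. *)

Require Import Defs.
From mathcomp Require Import all_boot all_order all_algebra.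
From mathcomp Require Import boolp classical_sets reals.
From mathcomp Require Import ring lra zify.

Set Implicit Arguments.
Unset Strict Implicit.
Unset Printing Implicit Defensive.

Import Order.TTheory GRing.Theory Num.Theory.
Local Open Scope ring_scope.

(** * Gordan's theorem of the alternative *)

Section Gordan.
Variables (R : realFieldType) (I : finType).
Implicit Types u v w : {ffun I -> R^o}.

Definition dot u v : R := \sum_i u i * v i.

Lemma dotC u v : dot u v = dot v u.
Proof. by apply: eq_bigr => i _; rewrite mulrC. Qed.

Lemma dotDl u v w : dot (u + v) w = dot u w + dot v w.
Proof. by rewrite -big_split; apply: eq_bigr => i _; rewrite ffunE mulrDl. Qed.

Lemma dotZl c u w : dot (c *: u) w = c * dot u w.
Proof.
by rewrite mulr_sumr; apply: eq_bigr => i _; rewrite ffunE -mulrA.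
Qed.

Lemma dotDr u v w : dot w (u + v) = dot w u + dot w v.
Proof. by rewrite !(dotC w) dotDl. Qed.

Lemma dotZr c u w : dot w (c *: u) = c * dot w u.
Proof. by rewrite !(dotC w) dotZl. Qed.

Lemma dot0r w : dot w 0 = 0.
Proof. by rewrite -(scale0r 0) dotZr mul0r. Qed.

Lemma dot_sumr m (p : 'I_m -> {ffun I -> R^o}) w :
  dot w (\sum_k p k) = \sum_k dot w (p k).
Proof. by apply: (big_morph (dot w) (fun u v => dotDr u v w) (dot0r w)). Qed.

Lemma dot_gt0 u : u != 0 -> 0 < dot u u.
Proof.
move=> u0; rewrite lt0r sumr_ge0 ?andbT => [|i _]; last exact: sqr_ge0.
apply: contra u0 => /eqP uu0; apply/eqP/ffunP => i; rewrite ffunE; apply/eqP.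
have /eqP : u i ^+ 2 = 0 := psumr_eq0P (fun j _ => sqr_ge0 (u j)) uu0 isT.
by rewrite expf_eq0.
Qed.

(** Allows a direction to be tilted without losing strict positivity: each index permits some
    positive [e], and finitely many of them have a positive minimum. *)
Lemma small_perturbation m (b c : 'I_m -> R) : (forall k, 0 < b k) ->
  exists2 e, 0 < e & forall k, 0 < b k + e * c k.
Proof.
elim: m b c => [|m IHm] b c b0; first by exists 1 => // -[].
have [e e0 He] := IHm (b \o lift ord0) (c \o lift ord0) (fun k => b0 _).
have bc0 : 0 < b ord0 / (`|c ord0| + 1) by rewrite divr_gt0 ?ltr_wpDl.
exists (Num.min e (b ord0 / (`|c ord0| + 1)) / 2).
  by rewrite divr_gt0 // lt_min e0.
set f := Num.min _ _.
have f0 : 0 < f by rewrite lt_min e0.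
have [fe fb] : f <= e /\ f * (`|c ord0| + 1) <= b ord0.
  by rewrite -ler_pdivlMr ?ltr_wpDl // !ge_min !lexx orbT.
move=> k; have [j ->|->] := unliftP ord0 k.
  (* The step taken lies between 0 and [e], so the value is a convex combination of two positive
     ones. *)
  have := He j; have := b0 (lift ord0 j); rewrite /=; nra.
have := b0 ord0; have := ler_norm (- c ord0); rewrite normrN; nra.
Qed.

(* Induction on [m], projecting the other points orthogonally to [q := p ord0].
   A direction positive on the projections can be tilted slightly towards [q];
   a vanishing combination of them makes a combination of the points equal to
   [c *: q], and if [c > 0] then [q] can simply be dropped. *)
Lemma gordan m (p : 'I_m -> {ffun I -> R^o}) :
  (exists w, forall k, 0 < dot w (p k)) \/
  (exists a : 'I_m -> R,
     [/\ forall k, 0 <= a k, exists k, 0 < a k & \sum_k a k *: p k = 0]).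
Proof.
elim: m p => [|m IHm] p; first by left; exists 0 => -[].
set q := p ord0; pose r k := p (lift ord0 k).
pose ext c (a : 'I_m -> R) k := if unlift ord0 k is Some j then a j else c.
have extP c a : 0 <= c -> (forall k, 0 <= a k) -> (exists k, 0 < a k) ->
    c *: q + \sum_k a k *: r k = 0 ->
  exists a : 'I_m.+1 -> R,
     [/\ forall k, 0 <= a k, exists k, 0 < a k & \sum_k a k *: p k = 0].
  move=> c0 a0 [k ak] E; exists (ext c a); split.
  - by move=> j; rewrite /ext; case: unlift.
  - by exists (lift ord0 k); rewrite /ext liftK.
  - rewrite big_ord_recl {1}/ext unlift_none -[RHS]E; congr (_ + _).
    by apply: eq_bigr => j _; rewrite /ext liftK.
have [q0|q0] := eqVneq q 0.
  right; exists (fun k => (k == ord0)%:R); split => [k||]; first exact: ler0n.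
    by exists ord0; rewrite eqxx ltr01.
  rewrite big_ord_recl eqxx scale1r -/q q0 add0r big1 // => k _.
  by rewrite scale0r.
have qq0 := dot_gt0 q0.
pose t v := dot v q / dot q q.
have [[w Hw]|[a [a0 ak E]]] := IHm (fun k => r k - t (r k) *: q).
  left; pose w' := w - t w *: q.
  have [k|e e0 He] := 
    @small_perturbation m (fun k => dot w' (r k)) (fun k => dot q (r k)).
    suff -> : dot w' (r k) = dot w (r k - t (r k) *: q) by exact: Hw.
    rewrite /w' -!scaleNr dotDl dotDr dotZl dotZr /t (dotC (r k) q).
    by rewrite !mulNr mulrAC [dot w q * _]mulrC mulrAC.
  exists (w' + e *: q) => k; have [j ->|->] := unliftP ord0 k.
    by rewrite dotDl dotZl; exact: He.
  (* [w'] is orthogonal to [q], so on [q] only the tilt counts. *)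
  rewrite -/q dotDl dotZl /w' -scaleNr dotDl dotZl mulNr divfK ?gt_eqF //.
  by rewrite subrr add0r mulr_gt0.
pose c := \sum_k a k * t (r k).
have {}E : \sum_k a k *: r k = c *: q.
  apply/eqP; rewrite -subr_eq0 /c scaler_suml; apply/eqP; rewrite -[RHS]E.
  under [RHS]eq_bigr do rewrite scalerBr scalerA.
  by rewrite sumrB.
have [c0|c0] := leP c 0.
  right; apply: (extP (- c) a) => //; first by rewrite oppr_ge0.
  by rewrite E scaleNr addNr.
have [[w Hw]|[b [b0 bk F]]] := IHm r; last first.
  by right; apply: (extP 0 b) => //; rewrite scale0r add0r.
(* [w] is positive on [q] too, since [c *: q] is a nontrivial nonnegative combination of the [r k]
   and [c] is positive. *)
left; exists w => k; have [j ->|->] := unliftP ord0 k; first exact: Hw.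
rewrite -(pmulr_rgt0 _ c0) -dotZr -/q -E dot_sumr.
have [j aj] := ak; rewrite (bigD1 j) //= dotZr ltr_pwDl ?mulr_gt0 //.
by apply: sumr_ge0 => i _; rewrite dotZr mulr_ge0 // ltW.
Qed.

End Gordan.

Lemma big_option (V : nmodType) (I : finType) (F : option I -> V) :
  \sum_o F o = F None + \sum_i F (Some i).
Proof.
rewrite (bigD1 None) //=; congr (_ + _).
by rewrite (reindex_omap Some id) => [|[]] //; apply: eq_bigl => i; rewrite eqxx.
Qed.

(** * One [LS_+] step on an arbitrary set *)

Section LSplusGeneral.
Variables (R : realType) (I : finType).
Implicit Types (P : set {ffun I -> R}) (x : {ffun I -> R}).

Lemma LSplus_liftE P x Y : LSplus_lift P Y -> column Y None = homog 1 x ->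
  [/\ Y None None = 1, forall i, Y (Some i) None = x i,
      forall i, Y None (Some i) = x i & forall i, Y (Some i) (Some i) = x i].
Proof.
move=> [[Ysym _] diag _ _] Y0.
have N i : Y (Some i) None = x i by move/ffunP/(_ (Some i)): Y0; rewrite !ffunE.
split=> [|//|i|i]; first by move/ffunP/(_ None): Y0; rewrite !ffunE.
  by rewrite Ysym.
by rewrite -N; move/ffunP/(_ (Some i)): diag; rewrite !ffunE.
Qed.

(* With [s] the value of the left-hand side, positive semidefiniteness at
   [(-s, w)] gives [s ^+ 2 <= w^T Y w], and the columns give [w^T Y w <= b * s]. *)
Lemma LSplus_le P (w : I -> R) (b : R) x :
  (forall i, 0 <= w i) -> 0 <= b ->
  (forall i y, w i != 0 -> P y -> y i = 1 -> \sum_j w j * y j <= b) ->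
  LSplus P x -> \sum_j w j * x j <= b.
Proof.
move=> w0 b0 wb [Y YP Y0]; have [Y00 YN NY YD] := LSplus_liftE YP Y0.
case: YP => -[_ Ypsd] _ Ycol _; set s := \sum_j _.
have colE i : exists y,
    [/\ P y, 0 <= x i & forall j, Y (Some j) (Some i) = x i * y j].
  have [c [y [c0 Py /ffunP E]]] := Ycol i.
  have ci : c = x i by have := E None; rewrite !ffunE NY.
  by exists y; split=> [//||j]; [rewrite -ci|have := E (Some j); rewrite !ffunE -ci].
have col_le i : w i * \sum_j w j * Y (Some j) (Some i) <= b * (w i * x i).
  have [->|wi] := eqVneq (w i) 0; first by rewrite !mul0r mulr0.
  have [y [Py xi0 E]] := colE i; rewrite mulrCA ler_wpM2l ?w0 //.
  have -> : \sum_j w j * Y (Some j) (Some i) = x i * \sum_j w j * y j.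
    by rewrite mulr_sumr; apply: eq_bigr => j _; rewrite E mulrCA.
  (* If [x i] is not 0, the diagonal condition forces [y i = 1] on the normalised column, so [wb]
     applies. *)
  have [->|xi] := eqVneq (x i) 0; first by rewrite mul0r mulr0.
  rewrite mulrC ler_wpM2r // (wb i) //.
  by apply: (mulfI xi); rewrite -E YD mulr1.
have s0 : 0 <= s.
  by apply: sumr_ge0 => j _; have [y [_ xj0 _]] := colE j; rewrite mulr_ge0.
have := Ypsd (fun o => if o is Some i then w i else - s).
rewrite big_option big_option Y00 /=.
under eq_bigr do rewrite NY.
rewrite [X in _ + X](_ : _ =
    - s * s + \sum_i w i * \sum_j w j * Y (Some j) (Some i)); last first.
  under eq_bigr do rewrite big_option YN.
  rewrite big_split /= mulr_sumr; congr (_ + _).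
    by apply: eq_bigr => i _; rewrite mulrC.
  under [RHS]eq_bigr do rewrite mulr_sumr.
  rewrite exchange_big; apply: eq_bigr => i _; apply: eq_bigr => j _.
  ring.
have -> : \sum_i - s * x i * w i = - s * s.
  by rewrite [RHS]mulr_sumr; apply: eq_bigr => i _; ring.
have : \sum_i w i * \sum_j w j * Y (Some j) (Some i) <= b * s.
  by rewrite mulr_sumr; apply: ler_sum => i _.
move=> h1 h2; have {h1}h2 : s * s <= b * s by nra.
have [->//|sn] := eqVneq s 0.
by rewrite -(ler_pM2r (_ : 0 < s)) // lt0r sn.
Qed.

(** Column [None] is the sum of column [Some i] and their difference; both lie in [cone P], with
    zeroth coordinates adding up to 1. *)
Lemma LSplus_segment P x (i : I) : LSplus P x ->
  exists c y z,
    [/\ 0 <= c <= 1, P y, P z & forall j, x j = c * y j + (1 - c) * z j].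
Proof.
move=> [Y YP Y0]; have [Y00 YN NY YD] := LSplus_liftE YP Y0.
case: YP => _ _ /(_ i)[c [y [c0 Py /ffunP E]]] /(_ i)[d [z [d0 Pz /ffunP F]]].
have cx : c = Y None (Some i) by have := E None; rewrite !ffunE.
have dx : d = 1 - c by have := F None; rewrite !ffunE Y00 -cx => <-.
exists c, y, z; split=> // [|j]; first by rewrite c0 -subr_ge0 -dx.
have := E (Some j); have := F (Some j); rewrite !ffunE YN -dx => <- ->; ring.
Qed.

End LSplusGeneral.

(** * [STAB], [FRAC] and valid inequalities *)

Section StableSets.
Variables (R : realType) (G : sgraph).
Implicit Types (x : {ffun G -> R}) (w : G -> R) (S K : {set G}).

(** Each step only produces convex combinations of earlier points, and these preserve the
    inequalities of [FRAC]. Splitting needs a vertex, which each inequality supplies. *)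
Lemma LSplus_iter_FRAC k x : LSplus_iter k x -> FRAC x.
Proof.
elim: k x => [//|k IHk] x /= xk.
have seg (i : G) : exists c y z, [/\ 0 <= c <= 1, FRAC y, FRAC z
    & forall j, x j = c * y j + (1 - c) * z j].
  have [c [y [z [c01 /IHk Fy /IHk Fz E]]]] := LSplus_segment i xk.
  by exists c, y, z.
split=> [i|i j ij]; have [c [y [z [/andP[c0 c1] [Fy Ey] [Fz Ez] E]]]] := seg i;
  rewrite !E.
  have /andP[? ?] := Fy i; have /andP[? ?] := Fz i; apply/andP; split; nra.
have := Ey _ _ ij; have := Ez _ _ ij; nra.
Qed.

(** Normalise by the total weight. If all weights vanish, [cone] still asks for a member of [STAB],
    and [x] is that member. *)
Lemma STAB_cone m (a : 'I_m -> R) (S : 'I_m -> {set G}) x :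
  (forall k, 0 <= a k) -> (forall k, stable (S k)) -> STAB x ->
  cone (@STAB R G) [ffun o => \sum_k a k * homog 1 (incidence R (S k)) o].
Proof.
move=> a0 Sst xS; set c := \sum_k a k.
have c0 : 0 <= c by apply: sumr_ge0 => k _.
have [cz|cn] := eqVneq c 0.
  exists 0, x; split=> //; apply/ffunP => o; rewrite !ffunE.
  have az k : a k = 0 by exact: (psumr_eq0P (fun k _ => a0 k) cz).
  by rewrite big1 => [|k _]; [case: o => // i; rewrite ffunE mul0r|rewrite az mul0r].
exists c, [ffun i => \sum_k (a k / c) * incidence R (S k) i]; split=> //.
  exists m, (fun k => a k / c), (fun k => incidence R (S k)); split=> //.
  - by move=> k; rewrite divr_ge0.
  - by rewrite -mulr_suml divff.
  - by move=> k; exists (S k).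
apply/ffunP => -[i|]; rewrite !ffunE.
  rewrite mulr_sumr; apply: eq_bigr => k _.
  by rewrite !ffunE mulrA mulrCA divff ?mulr1.
by apply: eq_bigr => k _; rewrite ffunE mulr1.
Qed.

(** The lift is the convex combination of the rank-one matrices of the homogenised incidence vectors
    [h k]. Its quadratic form is a sum of weighted squares, and the 0/1 entries give the diagonal
    condition. *)
Lemma STAB_LSplus (P : set {ffun G -> R}) x :
  (forall y, STAB y -> P y) -> STAB x -> LSplus P x.
Proof.
move=> SP xS; have [m [a [y [a0 a1 yS xE]]]] := xS.
have /choice[S Sy] k : exists S : {set G}, stable S /\ y k = incidence R S.
  by have [S] := yS k; exists S.
have Sst k : stable (S k) by have [] := Sy k.
pose h k := homog 1 (incidence R (S k)).
have hh k o : h k o * h k o = h k o.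
  by case: o => [i|]; rewrite !ffunE ?mulr1 //; case: (i \in _); rewrite ?mulr1 ?mulr0.
have h01 k o : 0 <= h k o <= 1.
  by case: o => [i|]; rewrite !ffunE ?ler01 ?lexx //; case: (i \in _); rewrite ?ler01 ?lexx.
have SPcone z : cone (@STAB R G) z -> cone P z.
  by move=> [c [u [c0 /SP Pu ->]]]; exists c, u.
pose Y o o' := \sum_k a k * h k o * h k o'; exists Y.
  split.
  - split=> [o o'|z]; first by apply: eq_bigr => k _; rewrite mulrAC.
    rewrite [leRHS](_ : _ = \sum_k a k * (\sum_o z o * h k o) ^+ 2).
      by apply: sumr_ge0 => k _; rewrite mulr_ge0 ?sqr_ge0.
    transitivity (\sum_o \sum_o' \sum_k a k * (z o * h k o * (z o' * h k o'))).
      apply: eq_bigr => o _; apply: eq_bigr => o' _.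
      rewrite mulr_sumr mulr_suml; apply: eq_bigr => k _; ring.
    under eq_bigr do rewrite exchange_big /=.
    rewrite exchange_big; apply: eq_bigr => k _; rewrite expr2 mulr_suml mulr_sumr.
    apply: eq_bigr => o _; rewrite !mulr_sumr; apply: eq_bigr => o' _; ring.
  - apply/ffunP => o; rewrite !ffunE; apply: eq_bigr => k _.
    by rewrite -mulrA [h k None]ffunE mulr1 -mulrA hh.
  - move=> i; apply: SPcone.
    have -> : column Y (Some i) = [ffun o => \sum_k a k * h k (Some i) * h k o].
      by apply/ffunP => o; rewrite !ffunE; apply: eq_bigr => k _; rewrite mulrAC.
    apply: STAB_cone xS => // k.
    by rewrite mulr_ge0 //; have /andP[] := h01 k (Some i).
  - move=> i; apply: SPcone.
    have -> : column Y None - column Y (Some i)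
        = [ffun o => \sum_k a k * (1 - h k (Some i)) * h k o].
      apply/ffunP => o; rewrite !ffunE /Y -sumrB; apply: eq_bigr => k _.
      have -> : h k None = 1 by rewrite ffunE.
      ring.
    apply: STAB_cone xS => // k.
    by rewrite mulr_ge0 // subr_ge0; have /andP[] := h01 k (Some i).
apply/ffunP => -[i|]; rewrite !ffunE.
  rewrite xE ffunE; apply: eq_bigr => k _; have [_ ->] := Sy k.
  by rewrite [h k None]ffunE mulr1 ffunE.
by rewrite -a1; apply: eq_bigr => k _; rewrite ffunE !mulr1.
Qed.

Lemma STAB_FRAC x : STAB x -> FRAC x.
Proof.
move=> [m [a [y [a0 a1 yS ->]]]].
have y01 k i : 0 <= y k i <= 1.
  by have [S _ ->] := yS k; rewrite ffunE ler0n lern1 leq_b1.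
split=> [i|i j ij]; rewrite !ffunE.
  rewrite sumr_ge0 => [|k _]; last by rewrite mulr_ge0 //; have /andP[] := y01 k i.
  rewrite -a1; apply: ler_sum => k _.
  by rewrite ler_piMr //; have /andP[] := y01 k i.
rewrite -big_split -a1 /=; apply: ler_sum => k _.
rewrite -mulrDr ler_piMr //; have [S Sst ->] := yS k; rewrite !ffunE -natrD lern1.
have := Sst i j; rewrite ij; case: (i \in S); case: (j \in S) => //= h.
by have := h isT isT.
Qed.

Lemma STAB_LSplus_iter k x : STAB x -> LSplus_iter k x.
Proof.
elim: k x => [|k IHk] x; first exact: STAB_FRAC.
by apply: STAB_LSplus.
Qed.

(** Validity on [STAB], tested on its generators only. *)
Definition valid w (b : R) := forall S, stable S -> \sum_(i in S) w i <= b.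

Definition supp w : {set G} := [set i | w i != 0]%SET.

Lemma stable0 : stable (finset.set0 : {set G}).
Proof. by move=> u v; rewrite inE. Qed.

Lemma stable_sub S (T : {set G}) : T \subset S -> stable S -> stable T.
Proof. by move=> /fintype.subsetP TS Sst u v /TS uS /TS; exact: Sst. Qed.

Lemma valid_ge0 w b : valid w b -> 0 <= b.
Proof. by move/(_ _ stable0); rewrite big_set0. Qed.

(* Gordan's alternative for the points [x - incidence S]; negative weights are
   truncated to 0, which is harmless since subsets of stable sets are stable. *)
Lemma STAB_of_valid x : (forall i, 0 <= x i) ->
  (forall w b, (forall i, 0 <= w i) -> valid w b -> \sum_i w i * x i <= b) ->
  STAB x.
Proof.
move=> x0 xv; pose A := [set S : {set G} | `[< stable S >]]%SET.
have AP S : reflect (stable S) (S \in A) by rewrite inE; exact: asboolP.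
pose p (k : 'I_#|A|) : {ffun G -> R^o} := x - incidence R (enum_val k).
have [[w wp]|[a [a0 [k ak] E]]] := gordan p.
  pose w' i := Num.max (w i) 0.
  pose b := \big[Num.max/0]_(S in A) \sum_(i in S) w' i.
  have w'0 i : 0 <= w' i by rewrite le_max lexx orbT.
  have wx S : stable S -> \sum_(i in S) w i < \sum_i w i * x i.
    move=> /AP SA; have := wp (enum_rank_in SA S).
    rewrite /p enum_rankK_in // /dot.
    under eq_bigr do rewrite !ffunE mulrBr.
    rewrite sumrB subr_gt0 => /(le_lt_trans _); apply.
    by rewrite big_mkcond; apply: ler_sum => i _; case: ifP; rewrite ?mulr1 ?mulr0.
  have ww' : \sum_i w i * x i <= \sum_i w' i * x i.
    by apply: ler_sum => i _; rewrite ler_wpM2r // le_max lexx.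
  have : b < \sum_i w' i * x i.
    apply/bigmax_ltP; split=> [|S /AP Sst].
      by apply: lt_le_trans ww'; have := wx _ stable0; rewrite big_set0.
    (* Dropping the vertices of nonpositive weight turns the truncated weight of [S] into an
       original weight of a stable set. *)
    have Tst : stable [set i in S | 0 < w i]%SET.
      by apply: stable_sub Sst; apply/fintype.subsetP => i; rewrite inE => /andP[].
    apply: lt_le_trans ww'; apply: le_lt_trans (wx _ Tst).
    rewrite big_mkcond [leRHS]big_mkcond; apply: ler_sum => i _; rewrite inE.
    by case: (i \in S) => //=; rewrite /w' maxC maxElt; case: ifP.
  rewrite ltNge => /negP[]; apply: xv => // S /AP SA.
  exact: le_bigmax_cond.
(* In the other alternative, dividing by the total weight writes [x] as a convex combination of
   incidence vectors. *)
pose c := \sum_k a k.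
have c0 : 0 < c.
  by rewrite /c (bigD1 k) //= ltr_pwDl // sumr_ge0.
exists #|A|, (fun k => a k / c), (fun k => incidence R (enum_val k)); split.
- by move=> j; rewrite divr_ge0 // ltW.
- by rewrite -mulr_suml divff // gt_eqF.
- by move=> j; exists (enum_val j) => //; apply/AP; exact: enum_valP.
apply/ffunP => i; rewrite ffunE; apply: (mulfI (lt0r_neq0 c0)).
move/ffunP/(_ i): E; rewrite sum_ffunE ffunE => /eqP.
under eq_bigr do rewrite !ffunE scalerBr.
rewrite sumrB subr_eq0 => /eqP E.
rewrite mulr_suml [LHS]E mulr_sumr; apply: eq_bigr => j _.
by rewrite ffunE mulrA mulrCA divff ?mulr1 // gt_eqF.
Qed.

End StableSets.

(** * Inequalities proved by [k] steps, by size of support *)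

Section Rank.
Variables (R : realType) (G : sgraph).
Implicit Types (x : {ffun G -> R}) (w : G -> R) (S K : {set G}).

Definition clique K := forall u v, u \in K -> v \in K -> u != v -> adj u v.

(** The bound is quantified inside, so that inductions only have to follow the weights. *)
Definition satisfies (k : nat) w :=
  forall b, valid w b -> forall x, LSplus_iter k x -> \sum_i w i * x i <= b.

Lemma stable_clique S K u v : stable S -> clique K ->
  u \in S -> u \in K -> v \in S -> v \in K -> u = v.
Proof.
move=> Sst Kcl uS uK vS vK; apply/eqP/negP => /negP uv.
by have := Sst _ _ uS vS; rewrite Kcl.
Qed.

Lemma stableU1 S v :
  stable S -> (forall u, u \in S -> ~~ adj v u) -> stable (v |: S)%SET.
Proof.
move=> Sst vS a b; rewrite !inE => /orP[/eqP->|aS] /orP[/eqP->|bS].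
- by rewrite adj_irrefl.
- exact: vS.
- by rewrite adj_sym vS.
- exact: Sst.
Qed.

Lemma sum_supp w S : \sum_(i in S) w i = \sum_(i in (S :&: supp w)%SET) w i.
Proof.
rewrite big_mkcond [RHS]big_mkcond; apply: eq_bigr => i _; rewrite !inE.
by case: (i \in S) => //=; have [->|] := eqVneq (w i) 0.
Qed.

(* Subtracting from [w] the largest multiple of the clique inequality of [K]
   that keeps it nonnegative lowers the maximum weight of a stable set by the
   same amount, because optimal stable sets can be taken to meet [K]. *)
Lemma satisfies_clique k w K v :
  (forall i, 0 <= w i) -> v \in K -> K \subset supp w -> clique K ->
  (forall x, LSplus_iter k x -> \sum_(i in K) x i <= 1) ->
  (forall S, stable S -> S \subset supp w -> [disjoint S & K] ->
     exists2 u, u \in K & stable (u |: S)%SET) ->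
  (forall w', (forall i, 0 <= w' i) -> supp w' \proper supp w -> satisfies k w') ->
  satisfies k w.
Proof.
move=> w0 vK Ksupp Kcl Kx Kadd IH b wb x xk.
have [m mK mmin] : exists2 m, m \in K & forall i, i \in K -> w m <= w i.
  by case: (arg_minP w vK) => m mK mmin; exists m.
pose t := w m; pose w' i := w i - (i \in K)%:R * t.
have w'0 i : 0 <= w' i.
  by rewrite /w'; case: (boolP (i \in K)) => iK;
    rewrite ?mul1r ?mul0r ?subr0 ?subr_ge0 ?mmin.
have w's i : i \in supp w' -> i \in supp w.
  have [/(fintype.subsetP Ksupp) ->//|iK] := boolP (i \in K).
  by rewrite !inE /w' (negbTE iK) mul0r subr0.
have w'p : supp w' \proper supp w.
  apply/properP; split; first exact/fintype.subsetP.
  exists m; first exact: (fintype.subsetP Ksupp).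
  by rewrite inE /w' mK mul1r subrr eqxx.
have w'b : valid w' (b - t).
  move=> S Sst; rewrite sum_supp; set T := (_ :&: _)%SET.
  have Tst : stable T by apply: stable_sub Sst; exact: finset.subsetIl.
  have Tsupp : T \subset supp w.
    by apply/fintype.subsetP => i /finset.setIP[_ /w's].
  (* If [T] misses [K], some [u] of weight at least [t] can be added; otherwise [T] meets [K]
     exactly once and loses exactly [t]. *)
  have [TK|] := boolP [disjoint T & K].
    have [u uK uT] := Kadd _ Tst Tsupp TK.
    have uNT : u \notin T.
      by apply: contraTN TK => ?; apply/pred0Pn; exists u; rewrite /= uK andbT.
    have := wb _ uT; rewrite big_setU1 //= => wu.
    have -> : \sum_(i in T) w' i = \sum_(i in T) w i.
      apply: eq_bigr => i iT; rewrite /w'.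
      have /negbTE -> : i \notin K.
        by apply: contraTN TK => ?; apply/pred0Pn; exists i; rewrite /= iT.
      by rewrite mul0r subr0.
    have := mmin _ uK; rewrite -/t; lra.
  move=> /pred0Pn[u /= /andP[uT uK]].
  rewrite sumrB lerB ?wb // (bigD1 u) //= uK mul1r big1 ?addr0 // => i /andP[iT iu].
  case: (boolP (i \in K)) => iK; last by rewrite mul0r.
  by case/eqP: iu; exact: (stable_clique Tst Kcl).
have := IH _ w'0 w'p _ w'b _ xk.
have -> : \sum_i w' i * x i = \sum_i w i * x i - t * \sum_(i in K) x i.
  rewrite mulr_sumr [X in _ - X]big_mkcond -sumrB; apply: eq_bigr => i _.
  by rewrite /w'; case: (i \in K) => /=; ring.
have := Kx _ xk; have := w0 m; rewrite -/t; nra.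
Qed.

(** A stable set within the support that avoids the closed neighbourhood of [v] can be enlarged by
    [v] itself. *)
Lemma satisfies_simplicial k w v :
  (forall i, 0 <= w i) -> v \in supp w ->
  clique (v |: (neighbourhood v :&: supp w))%SET ->
  (forall x, LSplus_iter k x ->
     \sum_(i in (v |: (neighbourhood v :&: supp w))%SET) x i <= 1) ->
  (forall w', (forall i, 0 <= w' i) -> supp w' \proper supp w -> satisfies k w') ->
  satisfies k w.
Proof.
move=> w0 vw cl le1; apply: (@satisfies_clique _ _ _ v) cl le1 _ => //.
- by rewrite !inE eqxx.
- apply/fintype.subsetP => i; rewrite in_setU1 => /predU1P[->//|].
  by rewrite finset.in_setI => /andP[].
move=> S Sst /fintype.subsetP Sw dS; exists v; first by rewrite !inE eqxx.
apply: stableU1 => // u uS; apply: contraTN dS => vu; apply/pred0Pn; exists u.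
by rewrite /= uS in_setU1 finset.in_setI Sw // inE vu orbT.
Qed.

(** Here the clique is a vertex or an edge, and its inequality is part of [FRAC], hence available
    for every [k]. *)
Lemma satisfies_deg1 k w v :
  (forall i, 0 <= w i) -> v \in supp w ->
  (#|(neighbourhood v :&: supp w)%SET| <= 1)%N ->
  (forall w', (forall i, 0 <= w' i) -> supp w' \proper supp w -> satisfies k w') ->
  satisfies k w.
Proof.
move=> w0 vw; set N := (_ :&: _)%SET => N1; apply: (@satisfies_simplicial _ _ v) => //.
  have adjN u : u \in N -> adj v u by rewrite finset.in_setI inE => /andP[].
  move=> a b; rewrite !in_setU1 => /predU1P[->|aN] /predU1P[->|bN]; rewrite ?eqxx //.
  - by rewrite adjN.
  - by rewrite adj_sym adjN.
  - by rewrite (card_le1_eqP N1 _ _ aN bN) eqxx.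
move=> x /LSplus_iter_FRAC[x01 xe].
have vN : v \notin N by rewrite finset.in_setI inE adj_irrefl.
rewrite -/N big_setU1 //=.
case: (posnP #|N|) => [/cards0_eq ->|N0].
  by rewrite big_set0 addr0; case/andP: (x01 v).
have /eqP/cards1P[u Nu] : #|N| = 1%N by apply/eqP; rewrite eqn_leq N1.
rewrite Nu big_set1; apply: xe.
by have : u \in N; [rewrite Nu inE|rewrite finset.in_setI inE => /andP[]].
Qed.

(** By [LSplus_le] only points with [y i = 1] matter. There [FRAC] forces 0 on the neighbours of
    [i], and the remaining weights have bound [b - w i] because [i] can join any stable set avoiding
    its closed neighbourhood. *)
Lemma satisfies_destruction k w :
  (forall i, 0 <= w i) ->
  (forall i w', i \in supp w -> (forall j, 0 <= w' j) ->
     supp w' \subset (supp w :\: (i |: neighbourhood i))%SET -> satisfies k w') ->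
  satisfies k.+1 w.
Proof.
move=> w0 IH b wb x; apply: LSplus_le => //; first exact: valid_ge0 wb.
move=> i y wi yk yi1; pose N := (i |: neighbourhood i)%SET.
pose w' j := if j \in N then 0 else w j.
have w'b : valid w' (b - w i).
  move=> S Sst; have : stable (i |: (S :\: N))%SET.
    apply: stableU1; first by apply: stable_sub Sst; exact: finset.subsetDl.
    by move=> u; rewrite finset.in_setD !inE negb_or -andbA => /and3P[].
  move/wb; rewrite big_setU1 ?finset.in_setD ?finset.in_setU1 ?eqxx //= => h.
  rewrite lerBrDl; apply: le_trans h; rewrite lerD2l le_eqVlt.
  apply/orP; left; apply/eqP.
  rewrite big_mkcond [RHS]big_mkcond; apply: eq_bigr => j _; rewrite /w' finset.in_setD.
  by case: (j \in N); case: (j \in S).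
have sw' : supp w' \subset (supp w :\: N)%SET.
  apply/fintype.subsetP => j; rewrite finset.in_setD !inE /w' in_setU1 inE.
  by case: ifP; rewrite ?eqxx.
have w'0 j : 0 <= w' j by rewrite /w'; case: ifP.
have isupp : i \in supp w by rewrite inE.
have := IH i w' isupp w'0 sw' _ w'b y yk.
rewrite lerBrDl => /(le_trans _); apply.
rewrite (bigD1 i) //= yi1 mulr1 lerD2l.
rewrite [leRHS](bigD1 i) //= /w' in_setU1 eqxx mul0r add0r.
apply: ler_sum => j ji; rewrite in_setU1 (negbTE ji) inE /=; case: ifP => // ij.
have [y01 ye] := LSplus_iter_FRAC yk.
have := ye _ _ ij; have /andP[yj0 _] := y01 j; rewrite yi1 => yj1.
have -> : y j = 0 by lra.
by rewrite mulr0 mul0r.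
Qed.

Lemma card_destruction (U : {set G}) i : i \in U ->
  (#|(neighbourhood i :&: U)%SET|
   + #|(U :\: (i |: neighbourhood i))%SET|).+1 = #|U|.
Proof.
move=> iU; rewrite -[RHS](cardsID (i |: neighbourhood i)%SET) -addSn.
have /finset.setIidPr iUE : [set i]%SET \subset U by rewrite finset.sub1set.
have iN : i \notin (U :&: neighbourhood i)%SET.
  by rewrite finset.in_setI [X in _ && X]inE adj_irrefl andbF.
by rewrite finset.setIUr iUE cardsU1 iN (finset.setIC U).
Qed.

(** Induction on the size of the support: while some vertex has at most one neighbour in it,
    [satisfies_deg1] passes to a smaller support. *)
Lemma satisfies_mindeg2 k m :
  (forall w, (forall i, 0 <= w i) -> (#|supp w| <= m)%N ->
     supp w != finset.set0 ->
     (forall v, v \in supp w -> (2 <= #|(neighbourhood v :&: supp w)%SET|)%N) ->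
     satisfies k w) ->
  forall w, (forall i, 0 <= w i) -> (#|supp w| <= m)%N -> satisfies k w.
Proof.
move=> Hk w; have [n] := ubnP #|supp w|; elim: n w => // n IHn w wn w0 wm.
have [s0 b wb x _|s0] := eqVneq (supp w) finset.set0.
  rewrite big1 ?(valid_ge0 wb) // => i _.
  by have := finset.in_set0 i; rewrite -s0 inE => /negbFE/eqP ->; rewrite mul0r.
have [/existsP[v /andP[vs v1]]|] :=
    boolP [exists v, (v \in supp w)
      && (#|(neighbourhood v :&: supp w)%SET| <= 1)%N].
  apply: (satisfies_deg1 w0 vs v1) => w' w'0 /proper_card w'w.
  by apply: IHn => //; lia.
rewrite negb_exists => /forallP big; apply: Hk => // v vs.
by have := big v; rewrite vs -ltnNge.
Qed.

Lemma satisfies_small k w : (forall i, 0 <= w i) ->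
  (#|supp w| <= 3 * k + 2)%N -> satisfies k w.
Proof.
elim: k w => [|k IHk]; apply: satisfies_mindeg2 => w w0 wm /finset.set0Pn[v vs] deg2.
  (* For [k = 0] a vertex with two neighbours already makes three vertices, against the bound 2. *)
  have := deg2 _ vs; have := card_destruction vs; lia.
apply: satisfies_destruction => // i w' iw w'0 /subset_leq_card w'w.
apply: IHk => //; have := deg2 _ iw; have := card_destruction iw; lia.
Qed.

(** The indicator of [K] has support [K], and a stable set meets a clique at most once. Needed for
    edges and triangles. *)
Lemma clique_le1 k K x : clique K -> (#|K| <= 3 * k + 2)%N ->
  LSplus_iter k x -> \sum_(i in K) x i <= 1.
Proof.
move=> Kcl Kk xk; pose w i : R := (i \in K)%:R.
have w0 i : 0 <= w i by exact: ler0n.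
have sK : supp w = K by apply/finset.setP => i; rewrite inE /w pnatr_eq0 eqb0 negbK.
have wv : valid w 1.
  move=> S Sst; have [SK|] := boolP [disjoint S & K].
    rewrite big1 // => i iS; rewrite /w; case: (boolP (i \in K)) => // iK.
    by case/pred0Pn: SK; exists i; rewrite /= iS.
  move=> /pred0Pn[u /= /andP[uS uK]].
  rewrite (bigD1 u) //= big1 ?addr0 /w ?uK // => i /andP[iS iu].
  case: (boolP (i \in K)) => // iK.
  by case/eqP: iu; exact: (stable_clique Sst Kcl).
have wk : satisfies k w by apply: satisfies_small => //; rewrite sK.
apply: le_trans (wk _ wv _ xk).
rewrite big_mkcond; apply: ler_sum => i _; rewrite /w.
by case: (i \in K); rewrite ?mul1r ?mul0r.
Qed.

(* With no vertex to unstretch, a vertex of degree at most 2 is simplicial, or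
   has a neighbour [v1] dominated by the other one; then the edge [v0 v1] can be
   subtracted. *)
Lemma satisfies_unstretchable k w : (0 < k)%N -> (forall i, 0 <= w i) ->
  (#|supp w| <= 3 * k + 3)%N -> supp w = finset.setT ->
  (forall v0 v1 v2 : G, (forall u, adj v0 u = (u == v1) || (u == v2)) ->
     ~~ adj v1 v2 -> v1 != v2 ->
     (forall u, adj v1 u -> adj v2 u) \/ (forall u, adj v2 u -> adj v1 u)) ->
  satisfies k w.
Proof.
move=> k0 w0 wk wT dom.
have smaller w' : (forall i, 0 <= w' i) -> supp w' \proper supp w -> satisfies k w'.
  by move=> w'0 /proper_card ?; apply: satisfies_small => //; lia.
have [/existsP[v0 v0deg]|] := 
    boolP [exists v : G, (#|neighbourhood v| <= 2)%N]; last first.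
  (* Minimum degree 3: each destruction removes at least 4 of at most [3 * k.+1 + 3] vertices,
     leaving at most [3 * k + 2]. *)
  rewrite negb_exists => /forallP deg3; case: k k0 wk smaller => // k _ wk _.
  apply: satisfies_destruction => // i w' iw w'0 /subset_leq_card w'w.
  apply: satisfies_small => //; have := card_destruction iw; have := deg3 i.
  rewrite {1}wT finset.setIT; lia.
have inw v : v \in supp w by rewrite wT inE.
have Nw v : (neighbourhood v :&: supp w = neighbourhood v)%SET by rewrite wT finset.setIT.
move: v0deg; rewrite leq_eqVlt => /orP[/cards2P[v1 [v2 [v12 N0]]]|]; last first.
  by rewrite -{1}Nw => /(satisfies_deg1 w0 (inw v0)); apply.
have nbr0 u : adj v0 u = (u == v1) || (u == v2).
  by have := congr1 (fun A : {set G} => u \in A) N0; rewrite !inE.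
have a1 : adj v0 v1 by rewrite nbr0 eqxx.
have a2 : adj v0 v2 by rewrite nbr0 eqxx orbT.
have [a12|na12] := boolP (adj v1 v2).
  have cl : clique (v0 |: neighbourhood v0)%SET.
    move=> a b; rewrite N0 !inE.
    by move=> /or3P[] /eqP-> /or3P[] /eqP->; rewrite ?eqxx // adj_sym.
  apply: (satisfies_simplicial w0 (inw v0)); rewrite ?Nw // => x.
  apply: clique_le1 => //; rewrite N0 cardsU1 cards2; lia.
wlog sub : v1 v2 v12 N0 nbr0 a1 a2 na12 / forall u, adj v1 u -> adj v2 u.
  move=> W; have [sub|sub] := dom _ _ _ nbr0 na12 v12; first exact: (W v1 v2).
  apply: (W v2 v1) => //;
    by rewrite 1?eq_sym 1?finset.setUC 1?adj_sym // => u; rewrite nbr0 orbC.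
have v01 : v0 != v1 by apply: contraTneq a1 => ->; rewrite adj_irrefl.
have cl : clique [set v0; v1]%SET.
  move=> a b; rewrite !inE.
  by move=> /orP[] /eqP-> /orP[] /eqP->; rewrite ?eqxx // adj_sym.
apply: (satisfies_clique (v := v0) w0 _ _ cl _ _ smaller).
- by rewrite !inE eqxx.
- by rewrite wT finset.subsetT.
- by move=> x; apply: clique_le1 => //; rewrite cards2; lia.
move=> S Sst _ dS.
(* If [v2] is in [S], nothing in [S] is adjacent to [v2], hence nothing to [v1]; otherwise [S]
   contains neither neighbour of [v0]. *)
have [v2S|v2S] := boolP (v2 \in S).
  exists v1; first by rewrite !inE eqxx orbT.
  apply: stableU1 => // u uS; apply: contraNN (Sst _ _ v2S uS); exact: sub.
exists v0; first by rewrite !inE eqxx.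
apply: stableU1 => // u uS; rewrite nbr0; apply/norP; split.
  by apply: contraTneq dS => e; apply/pred0Pn; exists u; rewrite /= uS e !inE eqxx orbT.
by apply: contraNneq v2S => <-.
Qed.

End Rank.

(** * Undoing a 2-stretching *)

Section Unstretch.
Variables (H : sgraph) (v0 v1 v2 : H).
Hypothesis nbr0 : forall u, adj v0 u = (u == v1) || (u == v2).
Hypothesis v1v2 : ~~ adj v1 v2.
Hypothesis v1Nv2 : exists2 u, adj v1 u & ~~ adj v2 u.
Hypothesis v2Nv1 : exists2 u, adj v2 u & ~~ adj v1 u.

Let rest := {u : H | [&& u != v0, u != v1 & u != v2]}.

(** [None] is the vertex obtained by merging [v0], [v1] and [v2]. *)
Definition unstretch_adj (a b : option rest) : bool :=
  match a, b with
  | Some x, Some y => adj (val x) (val y)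
  | Some x, None | None, Some x => adj v1 (val x) || adj v2 (val x)
  | None, None => false
  end.

Lemma unstretch_adj_sym : symmetric unstretch_adj.
Proof. by move=> [x|] [y|] //=; rewrite adj_sym. Qed.

Lemma unstretch_adj_irrefl : irreflexive unstretch_adj.
Proof. by move=> [x|] //=; rewrite adj_irrefl. Qed.

Definition unstretch : sgraph := SGraph unstretch_adj_sym unstretch_adj_irrefl.

Definition unstretch_end (k : 'I_2) : H := if k == ord0 then v1 else v2.

Definition unstretch_part (k : 'I_2) : {set unstretch} :=
  [set a : option rest |
    if a is Some x then adj (unstretch_end k) (val x) else false]%SET.

Lemma adj_v01 : adj v0 v1. Proof. by rewrite nbr0 eqxx. Qed.
Lemma adj_v02 : adj v0 v2. Proof. by rewrite nbr0 eqxx orbT. Qed.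

Lemma neq_v12 : v1 != v2.
Proof. by apply/eqP => e; have [u] := v1Nv2; rewrite e => ->. Qed.

Lemma in_rest (k : 'I_2) u : adj (unstretch_end k) u -> u != v0 ->
  [&& u != v0, u != v1 & u != v2].
Proof.
move=> au -> /=; apply/andP; split; apply: contraTneq au => ->;
  by rewrite /unstretch_end; case: ifP => _ //; rewrite ?adj_irrefl // adj_sym.
Qed.

(** A neighbour of one end that the other end does not see differs from [v0], which sees both, so it
    survives the merging. *)
Lemma unstretch_private (k j : 'I_2) : k != j ->
  exists x : rest,
    adj (unstretch_end k) (val x) && ~~ adj (unstretch_end j) (val x).
Proof.
have inR (i i' : 'I_2) u :
    adj (unstretch_end i) u -> ~~ adj (unstretch_end i') u ->
  exists x : rest,
    adj (unstretch_end i) (val x) && ~~ adj (unstretch_end i') (val x).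
  move=> au nu.
  suff u0 : u != v0 by exists (Sub u (in_rest au u0)); rewrite SubK au.
  apply: contraNneq nu => ->.
  by rewrite adj_sym /unstretch_end; case: ifP; rewrite (adj_v01, adj_v02).
have [u1 a1 n1] := v1Nv2; have [u2 a2 n2] := v2Nv1.
case: k => -[|[|//]] ?; case: j => -[|[|//]] ? // _; first exact: (inR _ _ u1).
exact: (inR _ _ u2).
Qed.

(** A private neighbour of end [k] makes part [k] nonempty; one of the other end makes it proper. *)
Lemma unstretch_data : @stretch_data unstretch None 2 unstretch_part.
Proof.
have other (k : 'I_2) : exists j, k != j.
  by exists (if k == ord0 then ord_max else ord0); case: k => -[|[|]].
split.
- move=> k; have [j kj] := other k; have [x /andP[ax _]] := unstretch_private kj.
  by apply/set0Pn; exists (Some x); rewrite inE.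
- move=> k; apply/properP; split.
    apply/fintype.subsetP => -[x|]; rewrite !inE //= /unstretch_end.
    by case: ifP => _ ->; rewrite ?orbT.
  have [j] := other k; rewrite eq_sym => jk.
  have [x /andP[ax nx]] := unstretch_private jk; exists (Some x); rewrite inE //=.
  by move: ax; rewrite /unstretch_end; case: ifP => _ ->; rewrite ?orbT.
- apply/finset.setP => -[x|]; rewrite !inE /=; last first.
    by apply/negbTE/bigcupP => -[k _]; rewrite inE.
  apply/bigcupP/orP => [[k _]|].
    by rewrite inE /unstretch_end; case: ifP => _; [left|right].
  by case=> ax; [exists ord0|exists ord_max] => //; rewrite inE.
Qed.

(** The inner [else v0] is a dummy value: [inl] carries only vertices different from [None]. *)
Definition unstretch_map (s : @stretch unstretch None 2 unstretch_part) : H :=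
  match s with
  | inl x => if val x is Some y then val y else v0
  | inr None => v0
  | inr (Some k) => unstretch_end k
  end.

Lemma unstretch_map_adj s t : adj (unstretch_map s) (unstretch_map t) = adj s t.
Proof.
have end0 k : adj v0 (unstretch_end k).
  by rewrite /unstretch_end; case: ifP; rewrite (adj_v01, adj_v02).
have end2 k j : adj (unstretch_end k) (unstretch_end j) = false.
  rewrite /unstretch_end; do 2!case: ifP => _; rewrite ?adj_irrefl ?(negbTE v1v2) //.
  by rewrite adj_sym (negbTE v1v2).
have rest0 (y : rest) : adj v0 (val y) = false.
  by rewrite nbr0; have /and3P[_ /negbTE-> /negbTE->] := valP y.
case: s => [[[x|] //= px]|[k|]]; case: t => [[[y|] //= py]|[j|]] //=;
  rewrite ?inE ?adj_irrefl ?end0 ?end2 ?rest0 //.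
- by rewrite adj_sym.
- by rewrite adj_sym rest0.
- by rewrite adj_sym end0.
Qed.

Lemma unstretch_map_inj : injective unstretch_map.
Proof.
have ne0 k : unstretch_end k != v0.
  apply/eqP => e; have := adj_irrefl v0; rewrite -{2}e /unstretch_end.
  by case: ifP; rewrite (adj_v01, adj_v02).
have neR (y : rest) k : val y != unstretch_end k.
  by rewrite /unstretch_end; have /and3P[_ ? ?] := valP y; case: ifP.
have neR0 (y : rest) : val y != v0 by have /and3P[] := valP y.
have inj2 k j : unstretch_end k = unstretch_end j -> k = j.
  have /eqP n12 := neq_v12; rewrite /unstretch_end.
  by case: k => -[|[|//]] ? /=; case: j => -[|[|//]] ? //= e;
    (exact: val_inj || case: n12).
case=> [[[x|] //= px]|[k|]] [[[y|] //= py]|[j|]] //= /eqP.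
- move=> /eqP/val_inj exy; subst y; congr inl; exact: val_inj.
- by rewrite (negbTE (neR _ _)).
- by rewrite (negbTE (neR0 _)).
- by rewrite eq_sym (negbTE (neR _ _)).
- by move=> /eqP/inj2 ->.
- by rewrite (negbTE (ne0 _)).
- by rewrite eq_sym (negbTE (neR0 _)).
- by rewrite eq_sym (negbTE (ne0 _)).
Qed.

(** Stated with [==] so that [xchoose] extracts an inverse. *)
Lemma unstretch_map_surj u : exists s, unstretch_map s == u.
Proof.
have [->|u0] := eqVneq u v0; first by exists (inr None) => /=.
have [->|u1] := eqVneq u v1; first by exists (inr (Some ord0)) => /=.
have [->|u2] := eqVneq u v2; first by exists (inr (Some ord_max)) => /=.
have pu : [&& u != v0, u != v1 & u != v2] by rewrite u0 u1 u2.
by exists (inl (exist _ (Some (exist _ u pu : rest) : unstretch) isT)) => /=.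
Qed.

Lemma unstretch_stretchings : stretchings 2 unstretch H.
Proof.
exists None, unstretch_part; split; first exact: unstretch_data.
pose f u := xchoose (unstretch_map_surj u).
have fK u : unstretch_map (f u) = u by apply/eqP/(xchooseP (unstretch_map_surj u)).
exists f; last by move=> u v; rewrite -unstretch_map_adj !fK.
exists unstretch_map => // s; exact/unstretch_map_inj/fK.
Qed.

End Unstretch.

(** * Application to minimal graphs *)

Theorem theorem16 (R : realType) (l : nat) (hl : (2 <= l)%N) (H : sgraph)
    (hH : minimal R l H) :
  exists G : sgraph, stretchings 2 G H.
Proof.
case: hH => cardH [_ /(_ l.-1)]; case: l hl cardH => // k k0 cardH /(_ (leqnn _)) neq.
(* With [l = k.+1], if [H] is not a 2-stretching then [k] steps already reach [STAB], against the
   rank. *)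
apply: contra_notP neq => nostretch.
apply/seteqP; split=> x; last exact: STAB_LSplus_iter.
move=> xk; apply: STAB_of_valid => [i|w b w0 wb].
  by have [/(_ i)/andP[]] := LSplus_iter_FRAC xk.
(* A support that is not full has at most [3 * k + 2] vertices. *)
have [sT|sT] := eqVneq (supp w) finset.setT; last first.
  apply: (satisfies_small w0 _ wb xk).
  have : supp w \proper finset.setT by rewrite properT.
  by move/proper_card; rewrite cardsT cardH; lia.
apply: (satisfies_unstretchable _ w0 _ sT _ wb xk) => //.
  by rewrite sT cardsT cardH; lia.
move=> v0 v1 v2 nbr0 na12 v12; apply: contra_notP nostretch => nsub.
have Nsub (y z : H) : ~ (forall u, adj y u -> adj z u) ->
    exists2 u, adj y u & ~~ adj z u.
  by move=> /existsNP[u /not_implyP[? /negP ?]]; exists u.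
exists (unstretch v0 v1 v2); apply: unstretch_stretchings => //.
  by apply: Nsub => h; apply: nsub; left.
by apply: Nsub => h; apply: nsub; right.
Qed.
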